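(* Let $\mathcal G$ be a pointed, complete, simplicial fan in $\mathbb R^n$. For each ray $\rho\in\mathcal G^{(1)}$ choose $v_\rho$ with $\rho=\mathbb R_{\ge0}v_\rho$ and a real number $\lambda_\rho>0$; set $H_\rho=\{x:\langle x,v_\rho\rangle=\lambda_\rho\}$ and $\mathscr H_\rho=\{x:\langle x,v_\rho\rangle\le\lambda_\rho\}$. For each maximal cone $C\in\mathcal G^{(n)}$ let $x(C)$ be the unique point of $\bigcap_{\rho\in C^{(1)}}H_\rho$, where $C^{(1)}$ is the set of extremal rays of $C$. Let $P=\mathrm{conv}\{x(C):C\in\mathcal G^{(n)}\}$ and $\widetilde P=\bigcap_{\rho\in\mathcal G^{(1)}}\mathscr H_\rho$. Suppose that for all $C_i,C_j\in\mathcal G^{(n)}$ with $C_i\cap C_j\in\mathcal G^{(n-1)}$, the vector $x(C_i)-x(C_j)$ points to $C_i$ from $C_j$. Then $P=\widetilde P$, the outer normal fan of $P$ is $\mathcal G$, and $P$ has dimension $n$.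
   Context: A fan is a family of nonempty closed polyhedral cones closed under taking faces, any two of which intersect in a common face. It is complete if the union is $\mathbb R^n$, pointed if the intersection of all its cones is $\{0\}$, simplicial if every cone is spanned by linearly independent vectors. $\mathcal G^{(k)}$ is the set of $k$-dimensional cones. For $C\in\mathcal G^{(n)}$ and an $(n-1)$-dimensional face $f$ of $C$, an outer normal of $C$ relative to $f$ is a vector $v$ normal to the hyperplane spanned by $f$ with $C\subseteq\{x:\langle x,v\rangle\le0\}$. For adjacent maximal cones $C_i,C_j$ (i.e. $C_i\cap C_j\in\mathcal G^{(n-1)}$), a vector $u$ points to $C_i$ from $C_j$ if there is an outer normal $v$ of $C_j$ relative to $C_i\cap C_j$ with $\langle u,v\rangle>0$.
   Formalization: The fan is assumed to be a finite family of cones, the usual convention; for infinite families the claim fails (e.g. unit rays in the plane at angles 1/k, 0 and finitely many others, all λ = 1, where P differs from P̃). *)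

(* Defs.v *)
From mathcomp Require Import all_boot all_order all_algebra.
From mathcomp Require Import all_classical all_reals.

Set Implicit Arguments.
Unset Strict Implicit.
Unset Printing Implicit Defensive.

Import Order.TTheory GRing.Theory Num.Theory.
Local Open Scope classical_set_scope.
Local Open Scope ring_scope.

Section Polyhedra.
Variables (R : realType) (n : nat).
Local Notation vec := 'rV[R]_n.
Implicit Types (x y u v : vec) (K F C D f P N rho : set vec).

Definition dot x y : R := \sum_(i < n) x 0 i * y 0 i.

Definition affine_hull K : set vec :=
  [set x | exists (m : nat) (a : 'rV[R]_m) (p : 'I_m -> vec),
     [/\ forall i, K (p i), \sum_(i < m) a 0 i = 1
       & x = \sum_(i < m) a 0 i *: p i]].

Definition convex_hull K : set vec :=
  [set x | exists (m : nat) (a : 'rV[R]_m) (p : 'I_m -> vec),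
     [/\ forall i, K (p i), forall i, 0 <= a 0 i, \sum_(i < m) a 0 i = 1
       & x = \sum_(i < m) a 0 i *: p i]].

(* The conic hull of the rows of [B]. *)
Definition cone_of_rows (k : nat) (B : 'M[R]_(k, n)) : set vec :=
  [set x | exists a : 'rV[R]_k, (forall i, 0 <= a 0 i) /\ x = a *m B].

(* [K] has dimension [d] when its affine hull is the translate by some [x0] of
   a [d]-dimensional linear subspace, given by a basis; no [d] fits [set0]. *)
Definition has_dim K (d : nat) : Prop :=
  exists (x0 : vec) (B : 'M[R]_(d, n)),
    row_free B /\
    affine_hull K = [set x | exists a : 'rV[R]_d, x = x0 + a *m B].

(* [v = 0] is allowed, so that [K] is a face of itself. On a cone a nonempty
   face forces [c = 0]. *)
Definition face K F : Prop :=
  F !=set0 /\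
  exists (v : vec) (c : R),
    (forall x, K x -> dot x v <= c) /\ F = K `&` [set x | dot x v = c].

(* Finite intersection of closed linear half-spaces; such a set is closed and
   contains 0. *)
Definition polyhedral_cone C : Prop :=
  exists (m : nat) (w : 'I_m -> vec), C = [set x | forall i, dot x (w i) <= 0].

(* Fans are finite families, the usual convention for polyhedral fans. *)
Record fan (G : set (set vec)) : Prop := Fan {
  fan_finite : finite_set G;
  fan_cone : forall C, G C -> polyhedral_cone C;
  fan_face : forall C F, G C -> face C F -> G F;
  fan_inter : forall C D, G C -> G D -> face C (C `&` D) /\ face D (C `&` D)
}.

Definition complete_fan (G : set (set vec)) : Prop :=
  \bigcup_(C in G) C = setT.

Definition pointed_fan (G : set (set vec)) : Prop :=
  \bigcap_(C in G) C = [set 0].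

Definition simplicial_fan (G : set (set vec)) : Prop :=
  forall C, G C ->
    exists (k : nat) (B : 'M[R]_(k, n)), row_free B /\ C = cone_of_rows B.

Definition cones_of_dim (G : set (set vec)) (k : nat) : set (set vec) :=
  [set C | G C /\ has_dim C k].

Definition extremal_rays C : set (set vec) :=
  [set rho | face C rho /\ has_dim rho 1].

(* As [f] is a face of a cone, it contains 0 and its affine hull is its linear
   span. *)
Definition outer_normal C f v : Prop :=
  [/\ v != 0, forall x, affine_hull f x -> dot x v = 0
    & forall x, C x -> dot x v <= 0].

(* Stated with [d.+1 = n] because [n.-1] would be 0 for [n = 0]. *)
Definition adjacent (G : set (set vec)) C D : Prop :=
  [/\ cones_of_dim G n C, cones_of_dim G n D
    & exists d : nat, d.+1 = n /\ cones_of_dim G d (C `&` D)].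

Definition points_to u C D : Prop :=
  exists v, outer_normal D (C `&` D) v /\ 0 < dot u v.

Definition normal_cone P F : set vec :=
  [set v | forall x y, F x -> P y -> dot y v <= dot x v].

Definition outer_normal_fan P : set (set vec) :=
  [set N | exists F, face P F /\ N = normal_cone P F].

Section Realization.
Variables (G : set (set vec)) (v : set vec -> vec) (lambda : set vec -> R).

Definition hyperplane rho : set vec := [set x | dot x (v rho) = lambda rho].

Definition halfspace rho : set vec := [set x | dot x (v rho) <= lambda rho].

(* [xget 0 A] is a point of [A], or 0 if [A] is empty. *)
Definition vertex C : vec :=
  xget 0 (\bigcap_(rho in extremal_rays C) hyperplane rho).

Definition vertex_polytope : set vec :=
  convex_hull [set vertex C | C in cones_of_dim G n].

Definition halfspace_polyhedron : set vec :=
  \bigcap_(rho in cones_of_dim G 1) halfspace rho.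

End Realization.
End Polyhedra.

(* Main.v *)
Require Import Defs.
From mathcomp Require Import all_boot all_order all_algebra.
From mathcomp Require Import all_classical all_reals.
From mathcomp Require Import ring lra.
Import Order.TTheory GRing.Theory Num.Theory.
Local Open Scope classical_set_scope.
Local Open Scope ring_scope.

Set Implicit Arguments.
Unset Strict Implicit.
Unset Printing Implicit Defensive.

(* For a direction y, consider a maximal cone D maximizing <x(D), y>. If y were
   not in D, then y would lie strictly beyond some facet of D; completeness gives
   a maximal cone C across that facet, x(C) - x(D) is a positive multiple of the
   outer normal of that facet, and so <x(C), y> > <x(D), y>. Hence the maximizers
   are exactly the maximal cones containing y. This describes the support
   function of P, which gives P = P~ by separation (Farkas), and identifies the
   normal cone of the face of P exposed by w with the intersection of the maximal
   cones containing w, that is, the cone of G with w in its relative interior. *)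

(** * The standard scalar product *)

Section DotProduct.
Variables (R : realType) (n : nat).
Implicit Types x y z : 'rV[R]_n.

Lemma dotC x y : dot x y = dot y x.
Proof. by apply: eq_bigr => i _; rewrite mulrC. Qed.

Lemma dotDl x y z : dot (x + y) z = dot x z + dot y z.
Proof. by rewrite /dot -big_split; apply: eq_bigr => i _; rewrite mxE mulrDl. Qed.

Lemma dotZl t x y : dot (t *: x) y = t * dot x y.
Proof. by rewrite /dot mulr_sumr; apply: eq_bigr => i _; rewrite mxE mulrA. Qed.

Lemma dotBl x y z : dot (x - y) z = dot x z - dot y z.
Proof. by rewrite -scaleN1r dotDl dotZl mulN1r. Qed.

Lemma dotZr t x y : dot x (t *: y) = t * dot x y.
Proof. by rewrite dotC dotZl (dotC x). Qed.

Lemma dotBr x y z : dot x (y - z) = dot x y - dot x z.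
Proof. by rewrite dotC dotBl !(dotC x). Qed.

Lemma dot0l y : dot 0 y = 0.
Proof. by rewrite -(scale0r 0) dotZl mul0r. Qed.

Lemma dot0r y : dot y 0 = 0.
Proof. by rewrite dotC dot0l. Qed.

Lemma dot_suml m (p : 'I_m -> 'rV[R]_n) y :
  dot (\sum_i p i) y = \sum_i dot (p i) y.
Proof.
by elim/big_rec2: _ => [|i b x _ <-]; [exact: dot0l | rewrite dotDl].
Qed.

Lemma dot_mulmx k (a : 'rV[R]_k) (B : 'M[R]_(k, n)) y :
  dot (a *m B) y = \sum_i a 0 i * dot (row i B) y.
Proof. by rewrite mulmx_sum_row dot_suml; apply: eq_bigr => i _; rewrite dotZl. Qed.

Lemma dot_gt0 x : x != 0 -> 0 < dot x x.
Proof.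
move=> x0; rewrite lt0r sumr_ge0 ?andbT => [|i _]; last by rewrite -expr2 sqr_ge0.
apply: contra_neq x0 => /psumr_eq0P x0; apply/rowP => i; rewrite mxE.
by apply/eqP; rewrite -sqrf_eq0 expr2 x0 // => j _; rewrite -expr2 sqr_ge0.
Qed.

Lemma dot_rows_eq0 k (B : 'M[R]_(k, n)) y :
  row_full B -> (forall i, dot (row i B) y = 0) -> y = 0.
Proof.
move=> /(submx_full y)/submxP[a ya] By; apply/eqP; apply: contraT => /dot_gt0.
by rewrite {1}ya dot_mulmx big1 ?ltxx // => i _; rewrite By mulr0.
Qed.

Lemma dot_rows_prescribed k (B : 'M[R]_(k, n)) (t : 'I_k -> R) :
  row_free B -> exists y, forall i, dot (row i B) y = t i.
Proof.
move=> /row_freeP[B' BB']; exists (B' *m \col_i t i)^T => i.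
transitivity ((B *m (B' *m \col_i t i)) i 0); last by rewrite mulmxA BB' mul1mx mxE.
by rewrite [RHS]mxE; apply: eq_bigr => j _; rewrite mxE [in X in _ * X]mxE.
Qed.

End DotProduct.

(** * Farkas' lemma and convex hulls of finite sets *)

Section Separation.
Variable R : realType.

(* Induction on the number of generators: a vector x with [dot c x > 0] that is
   polar to all generators but the first lets one project along it onto the
   orthogonal complement of the first generator. *)
Lemma farkas n m (p : 'I_m -> 'rV[R]_n) (c : 'rV[R]_n) :
    (forall x, (forall i, dot (p i) x <= 0) -> dot c x <= 0) ->
  exists a : 'I_m -> R, (forall i, 0 <= a i) /\ c = \sum_i a i *: p i.
Proof.
elim: m p c => [|m IHm] p c pc.
  exists (fun=> 0); split=> //; rewrite big_ord0; apply/eqP.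
  by apply: contraT => /dot_gt0; rewrite ltNge pc // => -[].
have [qc|] := pselect (forall x, (forall i, dot (p (lift ord0 i)) x <= 0) ->
  dot c x <= 0).
  have [a [a0 ->]] := IHm _ _ qc.
  exists (fun j => oapp a 0 (unlift ord0 j)); split=> [j|].
    by case: unliftP => [i|] _ //=.
  rewrite big_ord_recl unlift_none scale0r add0r.
  by apply: eq_bigr => i _; rewrite liftK.
move=> /existsNP[z /not_implyP[qz /negP]]; rewrite -ltNge => cz.
set s := dot (p ord0) z.
have s0 : 0 < s.
  rewrite ltNge; apply: contraTN cz => s0; rewrite -leNgt; apply: pc => i.
  by case: (unliftP ord0 i) => [j|] ->.
(* [proj] maps into the orthogonal complement of [z]. Its adjoint, computed in [projE], is the
   projection along [z] onto the complement of [p ord0], so the projected data satisfy the induction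
   hypothesis. *)
pose proj x := x - (dot x z / s) *: p ord0.
have [|a [a0 ca]] := IHm (fun i => proj (p (lift ord0 i))) (proj c).
  have projE x y : dot (proj x) y = dot x (y - (dot (p ord0) y / s) *: z).
    by rewrite dotBl dotBr dotZl dotZr; ring.
  move=> x qx; rewrite projE; apply: pc => i.
  case: (unliftP ord0 i) => [j|] ->; first by rewrite -projE.
  by rewrite dotBr dotZr -/s mulfVK ?subrr // gt_eqF.
(* The coefficient of [p ord0] left over when [proj] is undone; it is nonnegative as [dot c z > 0]
   and [z] is polar to the other generators. *)
pose a0' := (dot c z - \sum_i a i * dot (p (lift ord0 i)) z) / s.
exists (fun j => oapp a a0' (unlift ord0 j)); split=> [j|].
  case: unliftP => [i|] _ //=.
  rewrite divr_ge0 ?(ltW s0) // subr_ge0 (le_trans _ (ltW cz)) //.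
  by apply: sumr_le0 => i _; rewrite mulr_ge0_le0.
rewrite big_ord_recl unlift_none /=.
rewrite -[LHS](subrK ((dot c z / s) *: p ord0)) -/(proj c) ca.
rewrite (eq_bigr (fun i => a i *: p (lift ord0 i)
    - (a i * dot (p (lift ord0 i)) z / s) *: p ord0)); last first.
  by move=> i _; rewrite scalerBr scalerA mulrA.
rewrite sumrB -scaler_suml -mulr_suml /a0' mulrBl scalerBl.
rewrite addrC addrA addrAC; congr (_ + _).
by apply: eq_bigr => i _; rewrite liftK.
Qed.

Lemma convex_hull_le n (K : set 'rV[R]_n) x y b :
  convex_hull K x -> (forall z, K z -> dot z y <= b) -> dot x y <= b.
Proof.
move=> [m [a [p [Kp a0 a1 ->]]]] Kb; rewrite dot_suml -[b]mul1r -a1 mulr_suml.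
by apply: ler_sum => i _; rewrite dotZl ler_wpM2l // Kb.
Qed.

Lemma sub_convex_hull n (K : set 'rV[R]_n) : K `<=` convex_hull K.
Proof.
move=> x Kx; exists 1, (const_mx 1), (fun=> x); split=> // [i||].
- by rewrite mxE.
- by rewrite big_ord1 mxE.
- by rewrite big_ord1 mxE scale1r.
Qed.

(** A convex combination at which [w] attains its bound [c] gives weight 0 to every point where [w]
    stays below [c]. *)
Lemma convex_hull_face_ge n (K : set 'rV[R]_n) x w c y b :
    convex_hull K x -> (forall z, K z -> dot z w <= c) -> dot x w = c ->
    (forall z, K z -> dot z w = c -> b <= dot z y) ->
  b <= dot x y.
Proof.
move=> [m [a [p [Kp a0 a1 xE]]]] Kc xc Kb.
have az i : a 0 i * (c - dot (p i) w) = 0.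
  apply: (psumr_eq0P (P := predT) (F := fun i => a 0 i * (c - dot (p i) w))) => //.
    by move=> j _; rewrite mulr_ge0 // subr_ge0 Kc.
  transitivity (1 * c - dot x w); last by rewrite mul1r xc subrr.
  rewrite xE dot_suml -a1 mulr_suml -sumrB.
  by apply: eq_bigr => j _; rewrite dotZl mulrBr.
rewrite xE dot_suml -[b]mul1r -a1 mulr_suml; apply: ler_sum => i _; rewrite dotZl.
have /eqP := az i; rewrite mulf_eq0 subr_eq0 => /orP[/eqP->|/eqP ci].
  by rewrite !mul0r.
by rewrite ler_wpM2l // Kb.
Qed.

(** Farkas' lemma after homogenization: each point of [K] gets an extra coordinate 1, which forces
    the coefficients to sum to 1. A polar vector [(u, t)] encodes the inequality [dot z u <= - t] on
    [K]. *)
Lemma finite_convex_hull_separation n (K : set 'rV[R]_n) x : finite_set K ->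
    (forall y b, (forall z, K z -> dot z y <= b) -> dot x y <= b) ->
  convex_hull K x.
Proof.
move=> /finite_seqP[s ->] sx.
pose p (i : 'I_(size s)) := s`_i.
have ps i : p i \in s by rewrite mem_nth.
have dot_row_mx (u : 'rV[R]_n) t (z : 'rV[R]_(n + 1)) :
    dot (row_mx u (t%:M : 'rV_1)) z = dot u (lsubmx z) + t * rsubmx z 0 0.
  rewrite /dot big_split_ord /= big_ord1; congr (_ + _).
    by apply: eq_bigr => i _; rewrite row_mxEl mxE.
  by rewrite row_mxEr !mxE eqxx mulr1n (ord1 ord0).
have [|a [a0]] := @farkas (n + 1) _ (fun i => row_mx (p i) 1%:M) (row_mx x 1%:M).
  move=> z pz; rewrite dot_row_mx mul1r -lerBrDr sub0r; apply: sx => u /= /(nthP 0).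
  move=> [i si <-].
  by have := pz (Ordinal si); rewrite dot_row_mx mul1r -lerBrDr sub0r.
move=> xE; exists (size s), (\row_i a i), p; split=> [//|i||]; first by rewrite mxE.
  have := congr1 (fun z => rsubmx z 0 0) xE.
  rewrite row_mxKr linear_sum summxE !mxE eqxx mulr1n => ->.
  by apply: eq_bigr => i _; rewrite linearZ /= row_mxKr !mxE eqxx mulr1.
have := congr1 lsubmx xE; rewrite row_mxKl linear_sum => ->.
by apply: eq_bigr => i _; rewrite linearZ /= row_mxKl mxE.
Qed.

End Separation.

(** * Maxima and common thresholds over finite sets *)

Lemma finite_set_argmax (R : realType) T (A : set T) (f : T -> R) :
  finite_set A -> A !=set0 -> exists2 x, A x & forall y, A y -> f y <= f x.
Proof.
elim/Pchoice: T => T in A f *; move=> /finite_seqP[s ->].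
elim: s => [[//]|x s IHs _].
have [->|s0] := eqVneq s [::].
  by exists x => [|y]; rewrite /= inE // => /eqP->.
have [|y ys fy] := IHs.
  by case: s s0 {IHs} => // y s _; exists y; rewrite /= mem_head.
have [xy|yx] := leP (f x) (f y).
  exists y => [|z]; rewrite /= inE ?[y \in _]ys ?orbT // => /predU1P[->|/fy] //.
exists x => [|z]; rewrite /= inE ?eqxx // => /predU1P[->|/fy] // zy.
exact: le_trans zy (ltW yx).
Qed.

Lemma finite_set_small (R : realType) T (A : set T) (Q : T -> R -> Prop) :
    finite_set A ->
    (forall x, A x -> exists2 d, 0 < d & forall e, 0 < e <= d -> Q x e) ->
  exists2 d, 0 < d & forall x e, A x -> 0 < e <= d -> Q x e.
Proof.
elim/Pchoice: T => T in A Q *; move=> /finite_seqP[s ->].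
elim: s => [_|x s IHs sQ]; first by exists 1.
have [|d d0 dQ] := IHs.
  by move=> y ys; apply: sQ; rewrite /= inE [_ \in _]ys orbT.
have [|d' d'0 d'Q] := sQ x; first by rewrite /= mem_head.
exists (Num.min d d') => [|y e]; first by rewrite lt_min d0.
rewrite /= inE le_min => /predU1P[->|ys] /and3P[e0 ed ed'].
  by apply: d'Q; rewrite e0.
by apply: dQ; rewrite ?e0.
Qed.

(** * Cones spanned by rows: dimension and faces *)

Section SimplicialCones.
Variables (R : realType) (n : nat).
Implicit Types (x y u : 'rV[R]_n) (K C F : set 'rV[R]_n).

Lemma affine_hull_line K x y t :
  K x -> K y -> affine_hull K (t *: x + (1 - t) *: y).
Proof.
move=> Kx Ky; exists 2, (\row_i if i == 0 then t else 1 - t).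
exists (fun i => if i == 0 then x else y); split=> [i||].
- by case: ifP.
- by rewrite big_ord_recl big_ord1 !mxE /= subrKC.
- by rewrite big_ord_recl big_ord1 !mxE.
Qed.

Lemma sub_affine_hull K : K `<=` affine_hull K.
Proof.
by move=> x Kx; have := affine_hull_line 1 Kx Kx; rewrite subrr scale0r addr0 scale1r.
Qed.

Lemma cone_scale k (B : 'M[R]_(k, n)) x t :
  0 <= t -> cone_of_rows B x -> cone_of_rows B (t *: x).
Proof.
move=> t0 [a [a0 ->]]; exists (t *: a); split=> [i|]; last by rewrite scalemxAl.
by rewrite mxE mulr_ge0.
Qed.

Lemma cone_row k (B : 'M[R]_(k, n)) i : cone_of_rows B (row i B).
Proof. by exists (delta_mx 0 i); split=> [j|]; rewrite ?mxE ?ler0n // rowE. Qed.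

Lemma affine_hull_cone k (B : 'M[R]_(k, n)) :
  affine_hull (cone_of_rows B) = [set x | (x <= B)%MS].
Proof.
apply/seteqP; split=> x /=.
  move=> [m [a [p [Bp _ ->]]]]; apply: summx_sub => i _; apply: scalemx_sub.
  by have [b [_ ->]] := Bp i; exact: submxMl.
move=> /submxP[a ->].
(* Positive and negative parts of the coefficients. Their difference becomes an affine combination,
   with weights 2 and -1, of two cone points, the first one halved. *)
pose b := \row_i Num.max (a 0 i) 0; pose c := \row_i Num.max (- a 0 i) 0.
have -> : a *m B = 2 *: (2^-1 *: (b *m B)) + (1 - 2) *: (c *m B).
  rewrite scalerA divff ?pnatr_eq0 // scale1r.
  have -> : 1 - 2 = -1 :> R by lra.
  rewrite scaleN1r -mulmxBl; congr (_ *m _); apply/rowP => i; rewrite !mxE.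
  by case: ltP => ?; case: ltP => ?; lra.
apply: affine_hull_line; first (apply: cone_scale; first lra).
  by exists b; split=> // i; rewrite mxE le_max lexx orbT.
by exists c; split=> // i; rewrite mxE le_max lexx orbT.
Qed.

Lemma has_dim_cone k (B : 'M[R]_(k, n)) :
  row_free B -> has_dim (cone_of_rows B) k.
Proof.
move=> Bfree; exists 0, B; split=> //; rewrite affine_hull_cone.
apply/seteqP; split=> x /=; first by move=> /submxP[a ->]; exists a; rewrite add0r.
by move=> [a ->]; rewrite add0r submxMl.
Qed.

Lemma has_dim_cone_full k (B : 'M[R]_(k, n)) :
  row_free B -> row_full B -> has_dim (cone_of_rows B) n.
Proof.
move=> Bfree Bfull; have kn : k = n by rewrite -(eqP Bfree) (eqP Bfull).
exact: (eq_ind _ (has_dim (cone_of_rows B)) (has_dim_cone Bfree) _ kn).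
Qed.

Lemma has_dim_inj K d e : has_dim K d -> has_dim K e -> d = e.
Proof.
suff le_dim d' e' : has_dim K d' -> has_dim K e' -> (d' <= e')%N.
  by move=> Kd Ke; apply/eqP; rewrite eqn_leq !le_dim.
move=> [x [B [/eqP Bfree KB]]] [x' [B' [/eqP B'free]]]; rewrite KB => BB'.
rewrite -Bfree -B'free; apply/mxrankS/row_subP => i.
have BB'x (a : 'rV_d') : exists b, x + a *m B = x' + b *m B'.
  by move: BB' => /(congr1 (@^~ (x + a *m B))) /= <-; exists a.
(* Subtracting the image of the base point removes the translations and leaves the directions. *)
have [b xb] := BB'x (delta_mx 0 i); have [c xc] := BB'x 0.
apply/submxP; exists (b - c); rewrite mulmxBl -[RHS]add0r -(subrr x') addrACA -opprD.
by rewrite -xb -xc -rowE mul0mx addr0 [x + _]addrC addrK.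
Qed.

(* On a cone, the value of a face functional on the face is 0, because faces
   of cones are stable under doubling. *)
Lemma face_coneP k (B : 'M[R]_(k, n)) F : face (cone_of_rows B) F ->
  exists2 u, (forall i, dot (row i B) u <= 0)
           & F = cone_of_rows B `&` [set x | dot x u = 0].
Proof.
move=> [[z Fz] [u [c [Bu FE]]]]; suff c0 : c = 0.
  by exists u => [i|]; [rewrite -c0; exact/Bu/cone_row | rewrite -c0].
move: Fz; rewrite FE => -[Bz /= uz].
have := Bu _ (cone_scale (ler0n R 2) Bz); rewrite dotZl uz => c2.
have := Bu _ (cone_scale (lexx 0) Bz); rewrite dotZl mul0r => c0.
lra.
Qed.

(** A functional that is nonpositive on the generators and vanishes at [a *m B] vanishes on each
    generator with nonzero coefficient. *)
Lemma face_cone_support k (B : 'M[R]_(k, n)) F (a b : 'rV[R]_k) :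
    face (cone_of_rows B) F -> (forall i, 0 <= a 0 i) -> F (a *m B) ->
    (forall i, 0 <= b 0 i) -> (forall i, a 0 i = 0 -> b 0 i = 0) ->
  F (b *m B).
Proof.
move=> /face_coneP[u Bu ->] a0 [_ /= /eqP]; rewrite dot_mulmx -oppr_eq0 -sumrN.
move=> /eqP/psumr_eq0P au b0 ab; split; first by exists b.
rewrite /= dot_mulmx big1 // => i _.
have /eqP : - (a 0 i * dot (row i B) u) = 0.
  by apply: au => // j _; rewrite oppr_ge0 mulr_ge0_le0.
rewrite oppr_eq0 mulf_eq0 => /orP[/eqP/ab->|/eqP->]; first by rewrite mul0r.
by rewrite mulr0.
Qed.

Lemma face_cone_row k (B : 'M[R]_(k, n)) F (a : 'rV[R]_k) i :
    face (cone_of_rows B) F -> (forall j, 0 <= a 0 j) -> F (a *m B) ->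
  a 0 i != 0 -> F (row i B).
Proof.
move=> BF a0 Fa ai; rewrite rowE; apply: (face_cone_support BF a0 Fa) => j.
  by rewrite mxE ler0n.
move=> aj; rewrite mxE (_ : j == i = false) ?andbF //.
by apply: contra_neqF ai => /eqP<-.
Qed.

(** A relative interior point of the cone: a face containing it is the whole cone. *)
Definition cone_center k (B : 'M[R]_(k, n)) : 'rV[R]_n := const_mx 1 *m B.

Lemma cone_center_in k (B : 'M[R]_(k, n)) : cone_of_rows B (cone_center B).
Proof. by exists (const_mx 1); split=> // i; rewrite mxE. Qed.

Lemma face_cone_center k (B : 'M[R]_(k, n)) F :
  face (cone_of_rows B) F -> F (cone_center B) -> cone_of_rows B `<=` F.
Proof.
move=> BF Fc x [a [a0 ->]]; apply: face_cone_support BF _ Fc a0 _ => i; rewrite mxE //.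
by move=> /eqP; rewrite oner_eq0.
Qed.

(** The functional exposing a face vanishes on it, so it is zero when the face spans the space. *)
Lemma face_full k (B : 'M[R]_(k, n)) j (B' : 'M[R]_(j, n)) F :
    face (cone_of_rows B) F -> F = cone_of_rows B' -> row_full B' ->
  F = cone_of_rows B.
Proof.
move=> /face_coneP[u _ FE] FB' B'full; suff u0 : u = 0.
  by rewrite FE u0; apply/seteqP; split=> x => [[]|] // ?; split; rewrite //= dot0r.
apply: (dot_rows_eq0 B'full) => i; have : F (row i B') by rewrite FB'; exact: cone_row.
by rewrite FE => -[].
Qed.

End SimplicialCones.

(** * Complete simplicial fans: maximal cones and their neighbours *)

Section Fans.
Variables (R : realType) (n : nat) (G : set (set 'rV[R]_n)).
Hypotheses (G_fan : fan G) (G_complete : complete_fan G).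
Hypothesis G_simplicial : simplicial_fan G.
Implicit Types (p u x y z : 'rV[R]_n) (C D K F : set 'rV[R]_n).

Lemma fan_interG C D : G C -> G D -> G (C `&` D).
Proof.
by move=> GC GD; apply: (fan_face G_fan GC); have [] := fan_inter G_fan GC GD.
Qed.

Lemma fan_sub_face C D : G C -> G D -> C `<=` D -> face D C.
Proof.
by move=> GC GD /setIidl CD; have [_] := fan_inter G_fan GC GD; rewrite CD.
Qed.

Lemma fan_center_sub k (B : 'M[R]_(k, n)) D :
  G (cone_of_rows B) -> G D -> D (cone_center B) -> cone_of_rows B `<=` D.
Proof.
move=> GB GD Dc; have [BF _] := fan_inter G_fan GB GD.
have Fc : (cone_of_rows B `&` D) (cone_center B) by split=> //; exact: cone_center_in.
by move=> x /(face_cone_center BF Fc)[].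
Qed.

Lemma simplicial_dim C d : G C -> has_dim C d ->
  exists B : 'M[R]_(d, n), row_free B /\ C = cone_of_rows B.
Proof.
move=> /G_simplicial[k [B [Bfree ->]]] Bd.
by rewrite (has_dim_inj Bd (has_dim_cone Bfree)); exists B.
Qed.

(** By closedness, a cone missing [p] misses [p + e *: u] for all small [e]. Hence a cone containing
    [p + d *: u], with [d] small enough for all cones at once, contains [p] too. *)
Lemma fan_germ p u : exists D e, [/\ G D, 0 < e, D p & D (p + e *: u)].
Proof.
pose Q D e := D (p + e *: u) -> D p.
have [D GD|d d0 dQ] := @finite_set_small R _ G Q (fan_finite G_fan).
  have [m [w DE]] := fan_cone G_fan GD.
  have [Dp|] := pselect (D p); first by exists 1 => // e _ _.
  rewrite {1}DE => /existsNP[i /negP]; rewrite -ltNge => wp.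
  have c0 : 0 < 1 + `|dot u (w i)| by rewrite ltr_pwDl.
  (* Up to this bound on [e] the violated inequality stays violated; the added 1 keeps the
     denominator positive. *)
  exists (dot p (w i) / (1 + `|dot u (w i)|)); first exact: divr_gt0.
  move=> e /andP[e0]; rewrite ler_pdivlMr // => ep; rewrite /Q DE => /(_ i).
  rewrite dotDl dotZl => Dw; exfalso.
  have := ler_norm (- dot u (w i)); rewrite normrN => uw.
  have : 0 <= e * (`|dot u (w i)| + dot u (w i)).
    by rewrite mulr_ge0 ?(ltW e0) //; lra.
  by lra.
have [D GD Dd] : (\bigcup_(C in G) C) (p + d *: u) by rewrite G_complete.
by exists D, d; split=> //; apply: dQ Dd => //; rewrite d0 lexx.
Qed.

(** A cone with the most generators is full-dimensional: otherwise, leaving its centre in a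
    direction outside its span would lead into a cone with a strictly larger span. *)
Lemma maximal_cone_exists : cones_of_dim G n !=set0.
Proof.
pose P k := `[< exists B : 'M[R]_(k, n), row_free B /\ G (cone_of_rows B) >].
have P_ex : exists k, P k.
  have [D GD _] : (\bigcup_(C in G) C) 0 by rewrite G_complete.
  have [k [B [Bfree DE]]] := G_simplicial GD.
  by exists k; apply/asboolP; exists B; rewrite -DE.
have P_le k : P k -> (k <= n)%N.
  by move=> /asboolP[B [/eqP rkB _]]; rewrite -rkB rank_leq_col.
case: (ex_maxnP P_ex P_le) => k /asboolP[B [Bfree GB]] kmax.
have [Bfull|] := boolP (row_full B).
  by exists (cone_of_rows B); split=> //; exact: has_dim_cone_full.
rewrite -sub1mx => /row_subPn[i nB].
have [D [e [GD e0 Dc De]]] := fan_germ (cone_center B) (row i 1%:M).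
have [j [B' [B'free DE]]] := G_simplicial GD.
have DB' x : D x -> (x <= B')%MS.
  by rewrite DE => -[a [_ ->]]; exact: submxMl.
have BB' : (B <= B')%MS.
  by apply/row_subP => l; apply: DB'; apply: (fan_center_sub GB GD Dc); exact: cone_row.
suff: (B < B')%MS.
  rewrite ltmxErank (eqP Bfree) (eqP B'free) BB' /= ltnNge kmax //.
  by apply/asboolP; exists B'; rewrite -DE.
rewrite ltmxE BB'; apply: contra nB => /(submx_trans _); apply.
rewrite -[row i _](scalerK (lt0r_neq0 e0)) scalemx_sub //.
rewrite -[_ *: _](addKr (cone_center B)) addmx_sub ?eqmx_opp ?DB' //.
Qed.

Lemma finite_maximal : finite_set (cones_of_dim G n).
Proof. by apply: sub_finite_set (fan_finite G_fan) => C []. Qed.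

(** The neighbour is the cone entered from the centre [a *m B] of the facet opposite row [i], in the
    direction [- row i B]. *)
Lemma adjacent_across_facet (B : 'M[R]_n) i :
    row_free B -> G (cone_of_rows B) ->
  exists D, adjacent G D (cone_of_rows B) /\
    forall j, j != i -> D (row j B).
Proof.
move=> Bfree GB; pose a : 'rV[R]_n := \row_j (j != i)%:R.
have [D [e [GD e0 Da De]]] := fan_germ (a *m B) (- row i B).
have a0 j : 0 <= a 0 j by rewrite mxE ler0n.
have Dj j : j != i -> D (row j B).
  move=> ji; have [BD _] := fan_inter G_fan GB GD.
  suff [] : (cone_of_rows B `&` D) (row j B) by [].
  apply: (face_cone_row BD a0); first by split=> //; exists a.
  by rewrite mxE ji oner_eq0.
exists D; split=> //.
have Bfull : row_full B by rewrite row_full_unit -row_free_unit.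
have [k [B' [B'free DE]]] := G_simplicial GD.
(* [D] spans the space: it contains the other rows, and row [i] is a multiple of the difference of
   two of its points. *)
have B'full : row_full B'.
  have DB' x : D x -> (x <= B')%MS by rewrite DE => -[b [_ ->]]; exact: submxMl.
  rewrite -sub1mx; apply: (submx_trans (submx_full _ Bfull)); apply/row_subP => j.
  have [->|/Dj/DB'//] := eqVneq j i.
  rewrite -[row i B](scalerK (lt0r_neq0 e0)) scalemx_sub //.
  have -> : e *: row i B = a *m B - (a *m B + e *: - row i B).
    by rewrite opprD addNKr scalerN opprK.
  by rewrite addmx_sub ?eqmx_opp ?DB'.
have Dn : has_dim D n.
  by rewrite DE; exact: has_dim_cone_full.
have GDB := fan_interG GD GB; have [l [B2 [B2free DB2]]] := G_simplicial GDB.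
split; [by split | by split=> //; exact: has_dim_cone | exists l].
split; last by split=> //; rewrite DB2; exact: has_dim_cone.
(* The dimension [l] is at least [n - 1], since the generators of the intersection together with row
   [i] span everything. *)
apply/eqP; rewrite eqn_leq; apply/andP; split; last first.
  rewrite -{1}(eqP Bfull) -addn1; apply: leq_trans (rank_leq_row (col_mx B2 (row i B))).
  apply/mxrankS/row_subP => j; rewrite -addsmxE.
  have [->|/Dj Dj'] := eqVneq j i; first exact: addsmxSr.
  apply: submx_trans (addsmxSl _ _); have : (D `&` cone_of_rows B) (row j B).
    by split=> //; exact: cone_row.
  by rewrite DB2 => -[b [_ ->]]; exact: submxMl.
(* If [l] were [n], both cones would equal their intersection, and the point reached would lie in
   [cone_of_rows B] although its coordinate [i] is [- e]. *)
rewrite ltn_neqAle -{2}(eqP B2free) rank_leq_col andbT; apply/eqP => ln.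
have B2full : row_full B2 by rewrite /row_full (eqP B2free) ln.
have [DF BF] := fan_inter G_fan GD GB; rewrite {1}DE in DF.
have BD : cone_of_rows B (a *m B + e *: - row i B).
  by rewrite -(face_full BF DB2 B2full) (face_full DF DB2 B2full) -DE.
case: BD => b [b0]; have -> : a *m B + e *: - row i B = (a - e *: delta_mx 0 i) *m B.
  by rewrite mulmxBl -scalemxAl -rowE scalerN.
move/(row_free_inj Bfree) => /rowP/(_ i); have := b0 i.
by rewrite !mxE !eqxx /= mulr1 => + bi; rewrite -bi; lra.
Qed.

End Fans.

(** * Rays of the fan and generators of its cones *)

Section Rays.
Variables (R : realType) (n : nat) (G : set (set 'rV[R]_n)).
Hypotheses (G_fan : fan G) (G_simplicial : simplicial_fan G).
Implicit Types (D rho : set 'rV[R]_n).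

Lemma cone_of_rV (r x : 'rV[R]_n) :
  cone_of_rows r x <-> exists2 t, 0 <= t & x = t *: r.
Proof.
split=> [[a [a0 ->]]|[t t0 ->]]; last first.
  by exists t%:M; split=> [i|]; rewrite ?mul_scalar_mx // ord1 mxE eqxx.
by exists (a 0 0) => //; rewrite {1}[a]mx11_scalar mul_scalar_mx.
Qed.

Lemma row_free_neq0 k (B : 'M[R]_(k, n)) i : row_free B -> row i B != 0.
Proof.
move=> /row_freeP[B' BB']; apply/eqP => Bi.
have := congr1 (fun M => row i M 0 i) BB'.
by rewrite row_mul Bi mul0mx !mxE eqxx => /eqP; rewrite eq_sym oner_eq0.
Qed.

Lemma fan_row_ray k (B : 'M[R]_(k, n)) i : row_free B -> G (cone_of_rows B) ->
  cones_of_dim G 1 (cone_of_rows (row i B)).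
Proof.
move=> Bfree GB; split; last first.
  by apply: has_dim_cone; rewrite /row_free rank_rV row_free_neq0.
apply: (fan_face G_fan GB); split.
  by exists (row i B); apply/cone_of_rV; exists 1; rewrite ?scale1r.
(* [u] vanishes on row [i] and is -1 on the other rows, so it exposes the ray. *)
have [u uB] := dot_rows_prescribed (fun j => - (j != i)%:R) Bfree.
exists u, 0; split=> [x [a [a0 ->]]|].
  rewrite dot_mulmx; apply: sumr_le0 => j _.
  by rewrite uB mulrN oppr_le0 mulr_ge0 // ler0n.
apply/seteqP; split=> x.
  move=> /cone_of_rV[t t0 ->]; split; first exact/cone_scale/cone_row.
  by rewrite /= dotZl uB eqxx oppr0 mulr0.
move=> [[a [a0 ->]] /= /eqP]; rewrite dot_mulmx -oppr_eq0 -sumrN => /eqP ua.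
have {}ua j : - (a 0 j * dot (row j B) u) = 0.
  apply: (psumr_eq0P _ ua) => // l _.
  by rewrite uB mulrN opprK mulr_ge0 // ler0n.
apply/cone_of_rV; exists (a 0 i) => //.
rewrite mulmx_sum_row (bigD1 i) //= big1 ?addr0 //.
by move=> j ji; have := ua j; rewrite uB ji mulrN1 opprK => ->; rewrite scale0r.
Qed.

Lemma row_ray_extremal k (B : 'M[R]_(k, n)) i D :
    row_free B -> G (cone_of_rows B) -> G D -> D (row i B) ->
  extremal_rays D (cone_of_rows (row i B)).
Proof.
move=> Bfree GB GD Di; have [Gi dimi] := fan_row_ray i Bfree GB; split=> //.
apply: (fan_sub_face G_fan Gi GD) => x /cone_of_rV[t t0 ->].
by have [l [B' [_ DE]]] := G_simplicial GD; rewrite DE in Di *; exact: cone_scale.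
Qed.

(** A generator of the ray has a nonzero coefficient on some row; that row lies on the face, hence
    spans the ray. *)
Lemma extremal_ray_row k (B : 'M[R]_(k, n)) rho :
    row_free B -> G (cone_of_rows B) -> extremal_rays (cone_of_rows B) rho ->
  exists i, rho = cone_of_rows (row i B).
Proof.
move=> Bfree GB [Brho rho1]; have Grho := fan_face G_fan GB Brho.
have [r [/eqP rfree rhoE]] := simplicial_dim G_simplicial Grho rho1.
have r0 : r != 0 by move: rfree; rewrite rank_rV; case: (r == 0).
have rr : rho r by rewrite rhoE; apply/cone_of_rV; exists 1; rewrite ?scale1r.
have [a [a0 ra]] : cone_of_rows B r.
  by have [_ [u [c [_ FE]]]] := Brho; move: rr; rewrite FE => -[].
have [i ai] : exists i, a 0 i != 0.
  apply: contrapT => /forallNP a00; move/eqP: r0; apply; rewrite ra.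
  rewrite (_ : a = 0) ?mul0mx //; apply/rowP => i; rewrite mxE; apply/eqP.
  exact/negPn/negP/a00.
exists i; have : rho (row i B).
  by apply: (face_cone_row Brho a0) ai; rewrite -ra.
rewrite rhoE => /cone_of_rV[t t0 Bi].
have {}t0 : 0 < t.
  rewrite lt0r t0 andbT; apply: contra_neq (row_free_neq0 i Bfree) => t00.
  by rewrite Bi t00 scale0r.
apply/seteqP; split=> x /cone_of_rV[s s0 ->]; apply/cone_of_rV; last first.
  by exists (s * t); rewrite ?Bi ?scalerA // mulr_ge0 // ltW.
exists (s / t); first by rewrite divr_ge0 // ltW.
by rewrite Bi scalerA mulfVK // gt_eqF.
Qed.

Lemma fan_bigcap T (A : set T) (f : T -> set 'rV[R]_n) :
  finite_set A -> A !=set0 -> (forall i, A i -> G (f i)) -> G (\bigcap_(i in A) f i).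
Proof.
elim/Pchoice: T => T in A f *; move=> /finite_seqP[s ->]; rewrite bigcap_seq.
elim: s => [[]//|i s IHs _ Gf]; rewrite big_cons.
have Gi : G (f i) by apply: Gf; rewrite /= mem_head.
have [->|s0] := eqVneq s [::]; first by rewrite big_nil setIT.
apply: fan_interG => //; apply: IHs => [|j js].
  by case: s s0 {Gf} => // j s _; exists j; rewrite /= mem_head.
by apply: Gf; rewrite /= inE [_ \in _]js orbT.
Qed.

End Rays.

(** * The vertices, and the support function they define *)

Section Realization.
Variables (R : realType) (n : nat) (G : set (set 'rV[R]_n)).
Hypotheses (G_fan : fan G) (G_complete : complete_fan G).
Hypothesis G_simplicial : simplicial_fan G.
Variables (v : set 'rV[R]_n -> 'rV[R]_n) (lambda : set 'rV[R]_n -> R).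
Hypothesis v_ray : forall rho, cones_of_dim G 1 rho ->
  rho = [set x | exists t : R, 0 <= t /\ x = t *: v rho].
Implicit Types (x y w : 'rV[R]_n) (C D K F rho : set 'rV[R]_n).

Local Notation X := (vertex v lambda).
Local Notation maximal := (cones_of_dim G n).

Lemma ray_generator k (B : 'M[R]_(k, n)) i : row_free B -> G (cone_of_rows B) ->
  exists2 s, 0 < s & row i B = s *: v (cone_of_rows (row i B)).
Proof.
move=> Bfree GB; have : cone_of_rows (row i B) (row i B).
  by apply/cone_of_rV; exists 1; rewrite ?scale1r.
rewrite {1}(v_ray (fan_row_ray G_fan i Bfree GB)) => -[s [s0 Bi]].
exists s => //; rewrite lt0r s0 andbT; apply: contra_neq (row_free_neq0 i Bfree) => s00.
by rewrite Bi s00 scale0r.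
Qed.

Lemma maximal_basis C : maximal C ->
  exists B : 'M[R]_n, [/\ row_free B, row_full B & C = cone_of_rows B].
Proof.
move=> [GC Cn]; have [B [Bfree ->]] := simplicial_dim G_simplicial GC Cn.
by exists B; split=> //; rewrite row_full_unit -row_free_unit.
Qed.

(** The extremal rays of [C] are spanned by the rows of a basis, so the hyperplane equations form an
    invertible linear system; the default 0 in [vertex] is therefore not reached for a maximal
    cone. *)
Lemma vertex_unique C : maximal C ->
  \bigcap_(rho in extremal_rays C) hyperplane v lambda rho = [set X C].
Proof.
move=> mC; have [B [Bfree Bfull CE]] := maximal_basis mC.
have GB : G (cone_of_rows B) by rewrite -CE; case: mC.
pose ray i := cone_of_rows (row i B).
have /choice[s s_gen] : forall i, exists s, 0 < s /\ row i B = s *: v (ray i).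
  by move=> i; have [s s0 Bi] := ray_generator i Bfree GB; exists s.
have [x xB] := dot_rows_prescribed (fun i => s i * lambda (ray i)) Bfree.
have hypE y : (\bigcap_(rho in extremal_rays C) hyperplane v lambda rho) y <->
    forall i, dot (row i B) y = s i * lambda (ray i).
  split=> [yC i|yB rho].
    have [_ ->] := s_gen i; rewrite dotZl dotC; congr (_ * _).
    apply: yC; rewrite CE; apply: (row_ray_extremal G_fan G_simplicial) => //.
    exact: cone_row.
  rewrite CE => /(extremal_ray_row G_fan G_simplicial Bfree GB)[i ->].
  have [s0 Bi] := s_gen i; apply: (mulfI (lt0r_neq0 s0)).
  by rewrite -dotZr -Bi dotC yB.
suff XE : \bigcap_(rho in extremal_rays C) hyperplane v lambda rho = [set x].
  suff -> : X C = x by [].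
  have : (\bigcap_(rho in extremal_rays C) hyperplane v lambda rho) x by rewrite XE.
  by move=> /(xgetI 0); rewrite -/(X C) XE.
apply/seteqP; split=> y; last by move=> ->; apply/hypE.
move=> /hypE yB; apply/eqP; rewrite -subr_eq0; apply/eqP.
by apply: (dot_rows_eq0 Bfull) => i; rewrite dotBr yB xB subrr.
Qed.

Lemma dot_vertex_ray C rho :
  maximal C -> extremal_rays C rho -> dot (X C) (v rho) = lambda rho.
Proof.
move=> mC Crho; have : [set X C] (X C) by [].
by rewrite -vertex_unique // => /(_ _ Crho).
Qed.

(** [y] is a combination of rays of the common face of [C] and [D], and on these both vertices
    satisfy the same equations. *)
Lemma dot_vertex_common C D y :
  maximal C -> maximal D -> C y -> D y -> dot (X C) y = dot (X D) y.
Proof.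
move=> mC mD Cy Dy; have [B [Bfree _ CE]] := maximal_basis mC.
have [[GC _] [GD _]] := (mC, mD).
have [CF _] := fan_inter G_fan GC GD; rewrite {1}CE in CF.
have GB : G (cone_of_rows B) by rewrite -CE.
have [a [a0 yE]] : cone_of_rows B y by rewrite -CE.
rewrite !(dotC _ y) yE !dot_mulmx.
apply: eq_bigr => i _; have [->|ai] := eqVneq (a 0 i) 0; first by rewrite !mul0r.
have [Ci Di] : (C `&` D) (row i B).
  by apply: (face_cone_row CF a0) ai; rewrite -yE.
have [s _ Bi] := ray_generator i Bfree GB; congr (_ * _).
rewrite !(dotC (row i B)) Bi !dotZr !dot_vertex_ray //;
  exact: (row_ray_extremal G_fan G_simplicial).
Qed.

Hypothesis vertex_points : forall Ci Cj, adjacent G Ci Cj ->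
  points_to (X Ci - X Cj) Ci Cj.

(* If y is not in D, some coordinate of y in the basis spanning D is negative,
   and the vertex of the neighbour across the opposite facet is higher. *)
Lemma vertex_improve D y : maximal D -> ~ D y ->
  exists2 C, maximal C & dot (X D) y < dot (X C) y.
Proof.
move=> mD; have [B [Bfree Bfull DE]] := maximal_basis mD.
have GB : G (cone_of_rows B) by rewrite -DE; case: mD.
have /submxP[a ->] := submx_full y Bfull.
move=> aD; have [i ai] : exists i, a 0 i < 0.
  apply: contrapT => /forallNP ai; apply: aD; rewrite DE; exists a; split=> // i.
  by rewrite leNgt; apply/negP/ai.
have [C [CD Cj]] := adjacent_across_facet G_fan G_complete G_simplicial i Bfree GB.
rewrite -DE in CD; have [mC _ _] := CD; exists C => //.
set u := X C - X D.
have [w [[_ CDw Dw] uw]] := vertex_points CD; rewrite -/u in uw.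
(* Both vertices agree on the common facet, so [u], like the outer normal [w], is orthogonal to it:
   pairings with either see only coordinate [i]. *)
have uj j : j != i -> dot (row j B) u = 0.
  move=> ji; rewrite dotC dotBl (@dot_vertex_common C D) ?subrr //; first exact: Cj.
  by rewrite DE; exact: cone_row.
have expand (b : 'rV_n) : dot (b *m B) u = b 0 i * dot (row i B) u.
  by rewrite dot_mulmx (bigD1 i) //= big1 ?addr0 // => j /uj->; rewrite mulr0.
have u0 : u != 0 by apply: contraTneq uw => ->; rewrite dot0l ltxx.
suff Biu : dot (row i B) u < 0.
  by rewrite -subr_gt0 -dotBl -/u dotC expand nmulr_lgt0.
have wj j : j != i -> dot (row j B) w = 0.
  move=> ji; apply/CDw/sub_affine_hull.
  by split; [exact: Cj | rewrite DE; exact: cone_row].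
have wi : dot (row i B) w <= 0 by apply: Dw; rewrite DE; exact: cone_row.
(* [0 < dot u w] and [dot (row i B) w <= 0] force [b 0 i < 0]; then [0 < dot u u] gives the sign of
   [dot (row i B) u]. *)
have /submxP[b ub] := submx_full u Bfull.
have bi : b 0 i < 0.
  rewrite ltNge; apply: contraTN uw => bi; rewrite ub -leNgt dot_mulmx (bigD1 i) //=.
  by rewrite big1 ?addr0 ?mulr_ge0_le0 // => j /wj->; rewrite mulr0.
by have := dot_gt0 u0; rewrite {1}ub expand nmulr_rgt0.
Qed.

(** By [vertex_improve], a cone whose vertex is highest in direction [y] contains [y]. *)
Lemma maximal_cover y : exists2 C, maximal C & C y /\
  forall D, maximal D -> dot (X D) y <= dot (X C) y.
Proof.
have [C mC Cmax] := finite_set_argmax (fun C => dot (X C) y) (finite_maximal G_fan)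
  (maximal_cone_exists G_fan G_complete G_simplicial).
exists C => //; split=> //; apply: contrapT => /(vertex_improve mC)[D /Cmax].
by rewrite leNgt => /negP.
Qed.

Lemma dot_vertex_le C D y :
  maximal C -> maximal D -> C y -> dot (X D) y <= dot (X C) y.
Proof.
move=> mC mD Cy; have [C' mC' [C'y C'max]] := maximal_cover y.
by rewrite (dot_vertex_common mC mC') // C'max.
Qed.

Lemma dot_vertex_max C y : maximal C ->
  (forall D, maximal D -> dot (X D) y <= dot (X C) y) -> C y.
Proof.
move=> mC Cmax; apply: contrapT => /(vertex_improve mC)[D /Cmax].
by rewrite leNgt => /negP.
Qed.

(** * The polytope, its inequalities, its normal fan and its dimension *)

Local Notation P := (vertex_polytope G v lambda).

Lemma vertex_in C : maximal C -> P (X C).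
Proof. by move=> mC; apply: sub_convex_hull; exists C. Qed.

Lemma dot_polytope_le C x y : maximal C -> C y -> P x -> dot x y <= dot (X C) y.
Proof.
move=> mC Cy /convex_hull_le; apply=> _ [D mD <-]; exact: dot_vertex_le.
Qed.

Lemma vertex_polytopeE : P = halfspace_polyhedron G v lambda.
Proof.
apply/seteqP; split=> x Px.
  (* A maximal cone containing [v rho] has [rho] as an extremal ray, so [lambda rho] is the maximum
     over [P] in direction [v rho]. *)
  move=> rho mrho; have Grho := mrho.1.
  have [C mC [Cv _]] := maximal_cover (v rho).
  rewrite /halfspace /= -(@dot_vertex_ray C) //; first exact: dot_polytope_le.
  split; last exact: mrho.2.
  apply: (fan_sub_face G_fan Grho mC.1); rewrite (v_ray mrho) => _ [t [t0 ->]].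
  by have [B [_ _ CE]] := maximal_basis mC; rewrite CE in Cv *; exact: cone_scale.
(* Conversely, expand [y] in the generators of a maximal cone [C] containing it: adding up the
   halfspace inequalities bounds [dot x y] by [dot (X C) y]. *)
apply: finite_convex_hull_separation.
  exact/finite_image/(finite_maximal G_fan).
move=> y b Kb; have [C mC [Cy _]] := maximal_cover y.
apply: le_trans (_ : dot (X C) y <= b); last by apply: Kb; exists C.
have [B [Bfree _ CE]] := maximal_basis mC.
have GB : G (cone_of_rows B) by rewrite -CE; case: mC.
have [a [a0 ->]] : cone_of_rows B y by rewrite -CE.
rewrite !(dotC _ (a *m B)) !dot_mulmx.
apply: ler_sum => i _; rewrite ler_wpM2l //.
have [s s0 Bi] := ray_generator i Bfree GB; rewrite Bi !dotZl ler_pM2l //.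
rewrite dotC (dotC _ (X C)) dot_vertex_ray //; first exact/Px/fan_row_ray.
by rewrite CE; apply: (row_ray_extremal G_fan G_simplicial) => //; exact: cone_row.
Qed.

(** The vertices on the face exposed by [w] are the [X C] with [w] in [C], and [X C] is highest in
    direction [y] exactly when [y] is in [C]. *)
Lemma normal_cone_face w c F :
    (forall x, P x -> dot x w <= c) -> F = P `&` [set x | dot x w = c] ->
    F !=set0 ->
  normal_cone P F = \bigcap_(C in [set C | maximal C /\ C w]) C.
Proof.
move=> Pc FE [z]; rewrite FE => -[Pz /= zc].
have Xc C : maximal C -> C w -> dot (X C) w = c.
  move=> mC Cw; apply/eqP; rewrite eq_le Pc; last exact: vertex_in.
  by rewrite -zc dot_polytope_le.
apply/seteqP; split=> y.
  move=> Ny C [mC Cw]; apply: (dot_vertex_max mC) => D mD.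
  by apply: Ny; [split; [exact: vertex_in | exact: Xc] | exact: vertex_in].
move=> Cy x x' [Px /= xc] Px'; apply: (convex_hull_face_ge Px) (xc) _.
  by move=> _ [C mC <-]; exact/Pc/vertex_in.
move=> _ [C mC <-] Cc; suff Cw : C w by apply: dot_polytope_le => //; exact: Cy.
by apply: (dot_vertex_max mC) => D mD; rewrite Cc; exact/Pc/vertex_in.
Qed.

Lemma bigcap_maximal_center k (B : 'M[R]_(k, n)) : G (cone_of_rows B) ->
  \bigcap_(C in [set C | maximal C /\ C (cone_center B)]) C = cone_of_rows B.
Proof.
move=> GB; apply/seteqP; split=> [z Cz|x Bx C [[GC _] Cc]]; last first.
  exact: (fan_center_sub G_fan GB GC Cc).
(* The segment from z through the centre can be prolonged inside a maximal
   cone C, which has the given cone as a face: hence z lies on that face. *)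
have [D [e [GD e0 Dc De]]] := fan_germ G_fan G_complete (cone_center B) (- z).
have [l [B' [_ DE]]] := G_simplicial GD.
(* A maximal cone through the centre of [D] contains [D], hence also the given cone. *)
have [C mC [Cc' _]] := maximal_cover (cone_center B'); have GC := mC.1.
have DC : D `<=` C by rewrite DE in GD *; exact: (fan_center_sub G_fan GD GC Cc').
have BC := fan_center_sub G_fan GB GC (DC _ Dc).
have [B2 [_ _ CE]] := maximal_basis mC.
have := fan_sub_face G_fan GB GC BC; rewrite CE => /face_coneP[u uB BE].
have Cu x : C x -> dot x u <= 0.
  rewrite CE => -[a [a0 ->]]; rewrite dot_mulmx sumr_le0 // => i _.
  by rewrite mulr_ge0_le0.
have Cz' : C z by apply: Cz; split=> //; exact: DC.
have cu : dot (cone_center B) u = 0.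
  by have := cone_center_in B; rewrite {1}BE => -[].
rewrite BE; split; first by rewrite -CE.
(* [u] vanishes at the centre and is nonpositive at the centre minus [e *: z], so [dot z u] is
   nonnegative. *)
apply/eqP; rewrite /= eq_le Cu //=; have := Cu _ (DC _ De).
by rewrite dotDl cu add0r scalerN -scaleNr dotZl mulNr oppr_le0 pmulr_rge0.
Qed.

Lemma outer_normal_fanE : outer_normal_fan P = G.
Proof.
apply/seteqP; split=> K.
  move=> [F [[F0 [w [c [Pc FE]]]] ->]]; rewrite (normal_cone_face Pc FE F0).
  apply: (fan_bigcap G_fan) => [||C [[]]//].
    by apply: sub_finite_set (finite_maximal G_fan) => C [].
  by have [C mC [Cw _]] := maximal_cover w; exists C.
move=> GK; have [k [B [_ KE]]] := G_simplicial GK; rewrite KE in GK *.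
have [C mC [Cc _]] := maximal_cover (cone_center B).
(* A cone of the fan is the normal cone of the face exposed by its centre. *)
pose F := P `&` [set x | dot x (cone_center B) = dot (X C) (cone_center B)].
have F0 : F !=set0 by exists (X C); split=> //; exact: vertex_in.
have Pc x : P x -> dot x (cone_center B) <= dot (X C) (cone_center B).
  exact: dot_polytope_le.
exists F; split.
  by split=> //; exists (cone_center B), (dot (X C) (cone_center B)).
by rewrite (normal_cone_face Pc erefl F0) bigcap_maximal_center.
Qed.

Hypothesis lambda_gt0 : forall rho, cones_of_dim G 1 rho -> 0 < lambda rho.

(* As all lambda are positive, a small multiple of every x lies in P. *)
Lemma vertex_polytope_dim : has_dim P n.
Proof.
exists 0, 1%:M; split; first by rewrite row_free_unit unitmx1.
apply/seteqP; split=> x _; first by exists x; rewrite mulmx1 add0r.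
have [rho mrho|d d0 dQ] := @finite_set_small R _ (cones_of_dim G 1)
    (fun rho e => dot (e *: x) (v rho) <= lambda rho)
    (sub_finite_set (fun C => @proj1 _ _) (fan_finite G_fan)).
  have c0 : 0 < 1 + `|dot x (v rho)| by rewrite ltr_pwDl.
  exists (lambda rho / (1 + `|dot x (v rho)|)); first exact/divr_gt0/c0/lambda_gt0.
  move=> e /andP[e0]; rewrite ler_pdivlMr // => el; rewrite dotZl.
  apply: le_trans el; rewrite ler_pM2l // (le_trans (ler_norm _)) //.
  by rewrite lerDr.
(* [x] is an affine combination of 0 and [d *: x], both of which satisfy every halfspace
   inequality. *)
have -> : x = d^-1 *: (d *: x) + (1 - d^-1) *: 0.
  by rewrite scaler0 addr0 scalerA mulVf ?scale1r // gt_eqF.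
rewrite vertex_polytopeE; apply: affine_hull_line => rho mrho.
  by apply: dQ => //; rewrite d0 lexx.
by rewrite /halfspace /= dot0l ltW // lambda_gt0.
Qed.

End Realization.

Theorem theorem3p1 (R : realType) (n : nat) (G : set (set 'rV[R]_n))
  (G_fan : fan G) (G_pointed : pointed_fan G) (G_complete : complete_fan G)
  (G_simplicial : simplicial_fan G)
  (v : set 'rV[R]_n -> 'rV[R]_n) (lambda : set 'rV[R]_n -> R)
  (v_ray : forall rho, cones_of_dim G 1 rho ->
     rho = [set x | exists t : R, 0 <= t /\ x = t *: v rho])
  (lambda_gt0 : forall rho, cones_of_dim G 1 rho -> 0 < lambda rho) :
  (forall C, cones_of_dim G n C ->
     \bigcap_(rho in extremal_rays C) hyperplane v lambda rho
       = [set vertex v lambda C]) /\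
  ((forall Ci Cj, adjacent G Ci Cj ->
      points_to (vertex v lambda Ci - vertex v lambda Cj) Ci Cj) ->
   [/\ vertex_polytope G v lambda = halfspace_polyhedron G v lambda,
       outer_normal_fan (vertex_polytope G v lambda) = G
     & has_dim (vertex_polytope G v lambda) n]).
Proof.
split; first exact: vertex_unique.
move=> points; split.
- exact: vertex_polytopeE.
- exact: outer_normal_fanE.
- exact: vertex_polytope_dim.
Qed.
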